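(* Let $a,b\in\mathbb{C}$ with $a\notin\{-1,-2,-3,\ldots\}$, $b\notin\{0,-1,-2,\ldots\}$ and $b\notin\{1+a,2+a,3+a,\ldots\}$. For $c\notin\{0,-1,-2,\ldots\}$ define $L_{a,c}:\omega\to\omega$ by $$L_{a,c}(x)_n=\sum_{k=0}^n\frac{(-n)_k(n+a)_k}{k!\,(c)_k}x_k,\qquad n\ge0.$$ Let $x=(x_n)_{n\ge0}$ be a sequence of complex numbers and let $\hat x$ be its binomial transform, $\hat x_n=\sum_{k=0}^n(-1)^k\binom nk x_k$. Then for all $n\ge 0$, $$L_{a,b}(\hat x)_n=(-1)^n\frac{(1+a-b)_n}{(b)_n}\,L_{a,1+a-b}(x)_n.$$
   Context: For $\gamma\in\mathbb{C}$ and an integer $k\ge 0$, the rising factorial is $(\gamma)_0=1$ and $(\gamma)_k=\gamma(\gamma+1)\cdots(\gamma+k-1)$ for $k>0$. $\omega$ denotes the complex vector space of all sequences $(x_n)_{n=0}^\infty$ of complex numbers. *)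

(* Defs.v *)
From mathcomp Require Import all_boot all_order all_algebra.
From mathcomp Require Import reals complex.

Set Implicit Arguments.
Unset Strict Implicit.
Unset Printing Implicit Defensive.

Import GRing.Theory.
Local Open Scope ring_scope.

Definition rising (F : fieldType) (g : F) (k : nat) : F :=
  \prod_(i < k) (g + i%:R).

Definition binomial_transform (F : fieldType) (x : nat -> F) : nat -> F :=
  fun n => \sum_(k < n.+1) (-1) ^+ k * 'C(n, k)%:R * x k.

(* Meaningful only when c is not in {0, -1, -2, ...}, so that no [rising c k]
   vanishes; for other c the convention 0^-1 = 0 applies. *)
Definition Lop (F : fieldType) (a c : F) (x : nat -> F) : nat -> F :=
  fun n => \sum_(k < n.+1)
    (rising (- n%:R) k * rising (n%:R + a) k) / (k`!%:R * rising c k) * x k.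

(* Main.v *)
(** Comparing coefficients of [x j], the claim is the Chu-Vandermonde identity
    [sum_i (-m)_i (p)_i / (i! (c)_i) = (c - p)_m / (c)_m] for [m = n - j],
    [p = n + a + j], [c = b + j], followed by the reversal
    [(b - a - n)_(n - j) = (-1)^(n - j) (1 + a - b + j)_(n - j)]. *)
Require Import Defs.
From mathcomp Require Import all_boot all_order all_algebra.
From mathcomp Require Import reals complex.
From mathcomp Require Import ring.

Import GRing.Theory.
Local Open Scope ring_scope.

Lemma rising0 (F : fieldType) (g : F) : rising g 0 = 1.
Proof. by rewrite /rising big_ord0. Qed.

Lemma risingSr (F : fieldType) (g : F) k :
  rising g k.+1 = rising g k * (g + k%:R).
Proof. by rewrite /rising big_ord_recr. Qed.

Lemma risingD (F : fieldType) (g : F) j k :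
  rising g (j + k) = rising g j * rising (g + j%:R) k.
Proof.
rewrite /rising big_split_ord; congr (_ * _).
by apply: eq_bigr => i _; rewrite natrD addrA.
Qed.

Lemma risingS (F : fieldType) (g : F) k :
  rising g k.+1 = g * rising (g + 1) k.
Proof. by rewrite -add1n risingD risingSr rising0 mul1r addr0. Qed.

Lemma rising_neq0 (F : fieldType) (g : F) k :
  (forall m : nat, g <> - m%:R) -> rising g k != 0.
Proof.
move=> hg; apply/prodf_neq0 => i _; rewrite addr_eq0; exact/eqP/hg.
Qed.

Lemma rising_opp_nat (F : fieldType) m k :
  rising (- m%:R : F) k = (-1) ^+ k * (m ^_ k)%:R.
Proof.
elim: k => [|k IHk]; first by rewrite rising0 mul1r.
rewrite risingSr IHk ffactnSr natrM.
have [km|mk] := leqP k m; first by rewrite natrB // exprS; ring.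
by rewrite ffact_small // !(mulr0, mul0r).
Qed.

(** Taken from last to first, the factors of one side are the negatives of those of the other. *)
Lemma rising_reverse (F : fieldType) (g : F) k :
  rising g k = (-1) ^+ k * rising (1 - g - k%:R) k.
Proof.
rewrite /rising (reindex_inj rev_ord_inj) /=.
have -> : (-1) ^+ k = \prod_(i < k) (-1) :> F by rewrite prodr_const card_ord.
rewrite -big_split; apply: eq_bigr => i _ /=.
by rewrite natrB // -natr1; ring.
Qed.

Lemma Lop_binomialE (F : numFieldType) (a c : F) x n :
  Lop a c x n =
  \sum_(k < n.+1)
    (-1) ^+ k * 'C(n, k)%:R * (rising (n%:R + a) k / rising c k) * x k.
Proof.
apply: eq_bigr => k _; congr (_ * _).
have k0 : (k`!%:R : F) != 0 by rewrite Num.Theory.pnatr_eq0 -lt0n fact_gt0.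
rewrite rising_opp_nat -bin_ffact natrM invfM.
(* With the inverse made opaque, [field] only has to cancel the factorial. *)
by move: (rising c k)^-1 => ci; field.
Qed.

(** Chu-Vandermonde cleared of denominators by the factor [rising c m]. Induction on [m] with [p]
    and [c] free, since Pascal's rule shifts both by 1. *)
Lemma chu_vandermonde (F : fieldType) (p c : F) m :
  \sum_(k < m.+1)
    (-1) ^+ k * 'C(m, k)%:R * (rising p k * rising (c + k%:R) (m - k))
  = rising (c - p) m.
Proof.
elim: m p c => [|m IHm] p c.
  by rewrite big_ord1 !rising0 !mul1r.
(* Split the last factor [c - p + m] as [(c + m) - p]. *)
have recurrence : rising (c - p) m.+1
    = (c + m%:R) * rising (c - p) m - p * rising (c + 1 - (p + 1)) m.
  by rewrite risingSr (_ : c + 1 - (p + 1) = c - p); ring.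
rewrite recurrence -(IHm p c) -(IHm (p + 1) (c + 1)).
rewrite big_ord_recl [in RHS]big_distrr /=.
(* Pascal's rule: the ['C(m, k)] half, with [p] pulled out of [rising p k.+1], is the sum at
   [p + 1], [c + 1]. *)
rewrite [X in _ + X = _](eq_bigr (fun k : 'I_m.+1 =>
    (-1) ^+ k.+1 * 'C(m, k.+1)%:R *
      (rising p k.+1 * rising (c + k.+1%:R) (m - k))
    - p * ((-1) ^+ k * 'C(m, k)%:R *
         (rising (p + 1) k * rising (c + 1 + k%:R) (m - k))))); last first.
  move=> k _; rewrite /bump /= add1n subSS binS natrD risingS exprS -natr1.
  by rewrite (_ : c + (k%:R + 1) = c + 1 + k%:R); ring.
rewrite sumrB -mulr_sumr addrA; congr (_ - _).
rewrite [X in _ + X]big_ord_recr /= (bin_small (ltnSn m)) mulr0 mul0r [X in _ + X]addr0.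
rewrite [in RHS]big_ord_recl /= bin0; congr (_ + _).
  by rewrite bin0 !addr0 !subn0 risingSr; ring.
apply: eq_bigr => k _; rewrite /bump /= add1n.
(* The last factor of [rising (c + k.+1%:R) (m - k)] is [c + m], whatever [k] is. *)
by rewrite -[in LHS](subnSK (ltn_ord k)) (risingSr _ (c + _)) natrB //; ring.
Qed.

Lemma mul_bin_subset n k j : (j <= k <= n)%N ->
  ('C(n, k) * 'C(k, j) = 'C(n, j) * 'C(n - j, k - j))%N.
Proof.
case/andP=> jk kn; have jn := leq_trans jk kn.
(* This multiplier turns both sides into [n!]. *)
apply/eqP; rewrite -(@eqn_pmul2r (j`! * (k - j)`! * (n - k)`!));
  last by rewrite !muln_gt0 !fact_gt0.
have nkE : (n - j - (k - j) = n - k)%N by rewrite subnBA // subnK.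
have := bin_fact (leq_sub2r j kn); rewrite nkE => njE.
have := bin_fact kn; rewrite -(bin_fact jk) -(bin_fact jn) -njE => binE.
rewrite -!mulnA in binE *; rewrite binE.
by apply/eqP; congr (_ * _)%N; rewrite mulnCA.
Qed.

(** Terms with [k < j] vanish. Shifting [k] by [j] and factoring out ['C(n, j)] and [rising p j]
    leaves [chu_vandermonde] at [p + j], [c + j], [n - j]. *)
Lemma chu_vandermonde_bin (F : fieldType) (p c : F) n j : (j <= n)%N ->
  \sum_(k < n.+1) (-1) ^+ k * 'C(n, k)%:R * 'C(k, j)%:R *
    (rising p k * rising (c + k%:R) (n - k))
  = (-1) ^+ j * 'C(n, j)%:R * rising p j * rising (c - p) (n - j).
Proof.
move=> jn.
have -> : c - p = c + j%:R - (p + j%:R) by ring.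
rewrite -chu_vandermonde mulr_sumr.
rewrite -(big_mkord xpredT (fun k => (-1) ^+ k * 'C(n, k)%:R * 'C(k, j)%:R *
    (rising p k * rising (c + k%:R) (n - k)))).
rewrite (big_cat_nat (n := j)) //=; last exact: leqW.
rewrite big_nat_cond big1 ?add0r; last first.
  by move=> k /andP[/andP[_ kj] _]; rewrite (bin_small kj) mulr0 mul0r.
rewrite -{1}[j]add0n big_addn subSn // big_mkord.
apply: eq_bigr => -[k /=]; rewrite ltnS => kle _.
have kn : (k + j <= n)%N by rewrite addnC -leq_subRL.
rewrite -[X in X * _ = _]mulrA -natrM mul_bin_subset ?leq_addl // addnK natrM.
rewrite [(k + j)%N]addnC risingD exprD subnDA natrD addrA.
ring.
Qed.

Theorem theorem4p1 (R : realType) (a b : R[i])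
    (ha : forall m : nat, a <> - m.+1%:R)
    (hb : forall m : nat, b <> - m%:R)
    (hab : forall m : nat, b <> m.+1%:R + a)
    (x : nat -> R[i]) (n : nat) :
  Lop a b (binomial_transform x) n =
    (-1) ^+ n * (rising (1 + a - b) n / rising b n) * Lop a (1 + a - b) x n.
Proof.
(* [hab] is exactly what makes [1 + a - b] an admissible lower parameter. *)
have hd m : 1 + a - b <> - m%:R.
  move=> e; apply: (hab m); rewrite -natr1.
  by rewrite -[LHS](subKr (1 + a)) e; ring.
have bn0 k : rising b k != 0 by exact: rising_neq0.
have dn0 k : rising (1 + a - b) k != 0 by exact: rising_neq0.
(* Padding with zero binomials makes the inner range independent of [k], so the sums can be
   exchanged. *)
have transform_widen (k : 'I_n.+1) : binomial_transform x k =
    \sum_(j < n.+1) (-1) ^+ j * 'C(k, j)%:R * x j.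
  rewrite /binomial_transform.
  rewrite (big_ord_widen n.+1 (fun j => (-1) ^+ j * 'C(k, j)%:R * x j)) //.
  rewrite big_mkcond; apply: eq_bigr => j _; case: ifP => // /negbT.
  by rewrite -leqNgt => kj; rewrite bin_small // mulr0 mul0r.
rewrite !Lop_binomialE.
under eq_bigr => k _ do rewrite transform_widen mulr_sumr.
rewrite exchange_big mulr_sumr; apply: eq_bigr => j _ /=.
have jn : (j <= n)%N by rewrite -ltnS.
(* Common denominator: [1 / rising b k] is [rising (b + k) (n - k) / rising b n]. *)
transitivity ((-1) ^+ j * x j / rising b n *
  \sum_(k < n.+1) (-1) ^+ k * 'C(n, k)%:R * 'C(k, j)%:R *
    (rising (n%:R + a) k * rising (b + k%:R) (n - k))).
  rewrite mulr_sumr; apply: eq_bigr => k _.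
  have kn : (k <= n)%N by rewrite -ltnS.
  have e : rising b n = rising b k * rising (b + k%:R) (n - k).
    by rewrite -risingD subnKC.
  have := bn0 n; rewrite e mulf_eq0 negb_or => /andP[b1 b2].
  by field; rewrite b1 b2.
rewrite chu_vandermonde_bin // (rising_reverse _ (b - _)).
have -> : 1 - (b - (n%:R + a)) - (n - j)%:R = 1 + a - b + j%:R.
  by rewrite natrB //; ring.
have -> : rising (1 + a - b) n
    = rising (1 + a - b) j * rising (1 + a - b + j%:R) (n - j).
  by rewrite -risingD subnKC.
have -> : (-1) ^+ n = (-1) ^+ j * (-1) ^+ (n - j) :> R[i].
  by rewrite -exprD subnKC.
by field; rewrite bn0 dn0.
Qed.
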